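(* Let $0 = k_0 < k_1 < \dots < k_p < k_{p+1} = n$ be integers, let $b_1,\dots,b_{p+1} \in \mathbb{R}$ be distinct, and let \[ \operatorname{Flag}_{b_1,\dots,b_{p+1}}(k_1,\dots,k_p,n) := \Bigl\{X\in\mathsf{S}^2(\mathbb{R}^n): \prod_{j=0}^{p}(X-b_{j+1}I_n)=0,\ \operatorname{tr}(X)=\sum_{j=0}^{p}(k_{j+1}-k_j)b_{j+1}\Bigr\} \] be the isospectral model of the flag manifold. Let $A\in\mathsf{S}^2(\mathbb{R}^n)$ have distinct eigenvalues and let $A=Q\operatorname{diag}(a_1,\dots,a_n)Q^{\mathsf T}$ be an eigenvalue decomposition with $Q\in\mathrm{O}_n(\mathbb{R})$. Then $X\in\operatorname{Flag}_{b_1,\dots,b_{p+1}}(k_1,\dots,k_p,n)$ is a stationary point of the Euclidean distance function $\delta_A$ if and only if \[ X=QP_\tau \operatorname{diag}(b_1 I_{k_1},\, b_2 I_{k_2-k_1},\,\dots,\,b_{p+1}I_{n-k_p})\, P_\tau^{\mathsf T}Q^{\mathsf T}, \] where $P_\tau$ is the permutation matrix associated to some $\tau\in\mathfrak{S}_n$. The number of distinct stationary points of $\delta_A$ is \[ \binom{n}{k_1,\,k_2-k_1,\,\dots,\,n-k_p}. \]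
   Context: $\mathsf{S}^2(\mathbb{R}^n)$ is the space of real symmetric $n\times n$ matrices, $\mathrm{O}_n(\mathbb{R})$ the real orthogonal group, $\mathfrak{S}_n$ the symmetric group on $n$ elements. The last displayed quantity is the multinomial coefficient $n!/\prod_{j=0}^{p}(k_{j+1}-k_j)!$. The isospectral model is defined by the equations in the claim, and is stated to have the second description \[ \operatorname{Flag}_{b_1,\dots,b_{p+1}}(k_1,\dots,k_p,n)=\bigl\{V\operatorname{diag}(b_1 I_{k_1}, b_2 I_{k_2-k_1},\dots,b_{p+1}I_{n-k_p})V^{\mathsf T}: V\in \mathrm{O}_n(\mathbb{R})\bigr\}; \] it is regarded as a smooth submanifold of $\mathsf{S}^2(\mathbb{R}^n)$. The Euclidean distance function is $\delta_A(X)=\tfrac12\lVert X-A\rVert^2$, where $\lVert Z\rVert^2=\sum_{i,j}z_{ij}^2$, considered here on the real model. A point $X$ of a submanifold $\mathcal{M}$ is a stationary point of $\delta_A$ if $\operatorname{tr}(Y^{\mathsf T}(X-A))=0$ for every $Y$ in the tangent space of $\mathcal{M}$ at $X$.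
   Formalization: For the set cut out by the equations, it is assumed that the trace condition determines the multiplicities of the b_j (else false: n=3, b=(0,1,2), X=I); for the orbit {V diag(b_1 I,...) V^T} the claim is proved for all distinct b_j. *)

(* Defs.v *)
From mathcomp Require Import all_boot all_order all_algebra all_fingroup.
From mathcomp Require Import all_classical all_reals all_analysis.
Set Implicit Arguments.
Unset Strict Implicit.
Unset Printing Implicit Defensive.
Import Order.TTheory GRing.Theory Num.Theory.
Import numFieldNormedType.Exports.
Local Open Scope classical_set_scope.
Local Open Scope ring_scope.

(* Indexing: a flag type k_0 < ... < k_(p+1) is a function [k : nat -> nat], of
   which only the values at 0, ..., p.+1 matter; [b : 'I_p.+1 -> R] is indexed
   from 0, so that [b j] stands for b_(j+1). *)

Definition flag_type (p n : nat) (k : nat -> nat) : Prop :=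
  [/\ k 0%N = 0%N, forall j, (j <= p)%N -> (k j < k j.+1)%N & k p.+1 = n].

Definition flag_mult (k : nat -> nat) (j : nat) : nat := (k j.+1 - k j)%N.

Definition symmetric_mx (R : realType) (n : nat) (X : 'M[R]_n) : Prop :=
  X^T = X.

Definition orthogonal_mx (R : realType) (n : nat) (Q : 'M[R]_n) : Prop :=
  Q *m Q^T = 1%:M.

(* A real symmetric matrix has exactly n eigenvalues counted with multiplicity,
   hence distinct ones iff there are n different eigenvalues. *)
Definition distinct_eigenvalues (R : realType) (n : nat) (A : 'M[R]_n) : Prop :=
  exists s : seq R, [/\ uniq s, size s = n & all (eigenvalue A) s].

(* The i-th diagonal entry is b j for the only j such that i lies in the j-th
   block, i.e. k j <= i < k j.+1. *)
Definition block_diag (R : realType) (p n : nat) (k : nat -> nat)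
    (b : 'I_p.+1 -> R) : 'M[R]_n :=
  diag_mx (\row_(i < n) \sum_(j < p.+1 | (k j <= i < k j.+1)%N) b j).

Definition isospectral_flag (R : realType) (p n : nat) (k : nat -> nat)
    (b : 'I_p.+1 -> R) : set 'M[R]_n :=
  [set X | [/\ symmetric_mx X,
               \prod_(j < p.+1) (X - (b j)%:M) = 0 &
               \tr X = \sum_(j < p.+1) (flag_mult k j)%:R * b j]].

Definition isospectral_orbit (R : realType) (p n : nat) (k : nat -> nat)
    (b : 'I_p.+1 -> R) : set 'M[R]_n :=
  [set X | exists2 V : 'M[R]_n,
             orthogonal_mx V & X = V *m block_diag n k b *m V^T].

(* [isospectral_flag] and [isospectral_orbit] coincide exactly when the trace
   equation leaves only one choice for the multiplicities of b 0, ..., b p.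
   For b = (0, 1, 2) and k = (0, 1, 2, 3) they differ: the identity matrix
   satisfies the equations, but it has spectrum (1, 1, 1). *)
Definition trace_determines_mult (R : realType) (p n : nat) (k : nat -> nat)
    (b : 'I_p.+1 -> R) : Prop :=
  forall m : 'I_p.+1 -> nat,
    (\sum_(j < p.+1) m j)%N = n ->
    \sum_(j < p.+1) (m j)%:R * b j =
      \sum_(j < p.+1) (flag_mult k j)%:R * b j ->
    forall j, m j = flag_mult k j.

(* Velocities at X of the C^oo curves ]-e, e[ -> M through X; this is the
   tangent space at X when M is a smooth submanifold. *)
Definition tangent_space (R : realType) (n : nat) (M : set 'M[R]_n)
    (X : 'M[R]_n) : set 'M[R]_n :=
  [set Y | exists2 e : R, 0 < e & exists c : R -> 'M[R]_n,
     [/\ forall t, `|t| < e -> M (c t),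
         forall (m : nat) (t : R), `|t| < e -> derivable (derive1n m c) t 1,
         c 0 = X &
         derive1 c 0 = Y]].

(* Stationary points on M of delta_A(X) = 1/2 * sum_(i, j) (X - A)_ij ^ 2,
   whose gradient in 'M[R]_n at X is X - A. *)
Definition stationary_points (R : realType) (n : nat) (M : set 'M[R]_n)
    (A : 'M[R]_n) : set 'M[R]_n :=
  [set X | M X /\
           forall Y, tangent_space M X Y -> \tr (Y^T *m (X - A)) = 0].

(* Main.v *)
Require Import Defs.
From mathcomp Require Import all_boot all_order all_algebra all_fingroup.
From mathcomp Require Import all_classical all_reals all_analysis.
From mathcomp Require Import ring.
Set Implicit Arguments.
Unset Strict Implicit.
Unset Printing Implicit Defensive.
Import Order.TTheory GRing.Theory Num.Theory.
Import numFieldNormedType.Exports.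
Local Open Scope classical_set_scope.
Local Open Scope card_scope.
Local Open Scope ring_scope.

(* Both models are stable under orthogonal conjugation, so at X they admit the
   velocities BX - XB of the curves t |-> exp(tB) X exp(-tB), B skew. Testing
   stationarity on them gives tr(B(AX - XA)) = 0 for enough skew matrices B,
   hence AX = XA, and X is diagonal in the eigenbasis Q of A since A has simple
   spectrum. Conversely, let X = Q diag(x) Q^T and f = \prod_j ('X - b_j).
   Differentiating f(c(t)) = 0 along any curve c in the model gives
   (Q^T Y Q)_ii f'(x_i) = 0 for its velocity Y; as f has simple roots, Q^T Y Q
   has zero diagonal and is orthogonal to the diagonal matrix Q^T (X - A) Q.
   The stationary points are thus in bijection with the distinct rearrangements
   of the sequence of block indices. *)

(** * Counting the rearrangements of a sequence *)

(** Induction on the size, splitting rearrangements by their first letter [x]: those of [rem x s]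
    remain. Passing from [s] to [rem x s] divides the product of factorials by the multiplicity of
    [x], and the multiplicities add up to [size s]. *)
Lemma size_permutations_count (T : finType) (s : seq T) :
  (size (permutations s) * \prod_(x : T) (count_mem x s)`! = (size s)`!)%N.
Proof.
have [n] := ubnP (size s); elim: n s => // n IHn s lesn.
have [s0|s_gt0] := posnP (size s).
  by rewrite (size0nil s0)/= big1 // => x _; rewrite fact0.
rewrite (perm_size (permutationsE s_gt0)) size_allpairs_dep sumnE big_map.
rewrite big_distrl /=.
have step x : x \in undup s ->
    (size (permutations (rem x s)) * \prod_(y : T) (count_mem y s)`! =
     count_mem x s * (size s).-1`!)%N.
  rewrite mem_undup => xs; rewrite -(size_rem xs) -IHn; last first.
    by rewrite size_rem // prednK // -ltnS.
  rewrite mulnCA; congr (_ * _)%N.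
  rewrite (bigD1 x) //= [in RHS](bigD1 x) //= mulnA; congr (_ * _)%N.
    rewrite (seq.permP (perm_to_rem xs)) /= eqxx add1n; exact: ssrnat.factS.
  apply: eq_bigr => y yx.
  by rewrite (seq.permP (perm_to_rem xs)) /= eq_sym (negbTE yx).
rewrite (eq_big_seq _ step) -big_distrl /=.
have -> : (\sum_(x <- undup s) count_mem x s = size s)%N.
  rewrite -[RHS](perm_size (perm_count_undup s)) size_flatten sumnE !big_map.
  by apply: eq_bigr => x _; rewrite size_nseq.
by rewrite -[in RHS](prednK s_gt0) ssrnat.factS prednK.
Qed.

(** * Differentiation of matrix-valued functions *)

Lemma is_derive_mxP (R : realFieldType) (V : normedModType R) (m n : nat)
    (F : V -> 'M[R]_(m, n)) (t v : V) (dF : 'M[R]_(m, n)) :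
  is_derive t v F dF <-> forall i j, is_derive t v (fun x => F x i j) (dF i j).
Proof.
split=> [dFt i j|dFt].
  have /derivable_mxP Fij := @ex_derive _ _ _ _ _ _ _ dFt.
  apply: DeriveDef; first exact: Fij.
  by rewrite -(@derive_val _ _ _ _ _ _ _ dFt) derive_mx ?mxE //; exact: ex_derive.
have Ft : derivable F t v by apply/derivable_mxP => i j; exact: ex_derive.
apply: DeriveDef => //; rewrite derive_mx //; apply/matrixP => i j.
by rewrite mxE; exact: derive_val.
Qed.

Lemma is_derive_mulmx (R : realFieldType) (V : normedModType R) (m n q : nat)
    (F : V -> 'M[R]_(m, n)) (G : V -> 'M[R]_(n, q)) (t v : V) dF dG :
  is_derive t v F dF -> is_derive t v G dG ->
  is_derive t v (fun x => F x *m G x) (dF *m G t + F t *m dG).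
Proof.
move=> /is_derive_mxP Ft /is_derive_mxP Gt; apply/is_derive_mxP => i j.
(* Written as a sum of products of functions, the entry is differentiated by the scalar rules. *)
rewrite (_ : (fun _ => _) =
    \sum_(l < n) ((fun x => F x i l) * (fun x => G x l j))); last first.
  by apply/funext => x; rewrite mxE fct_sumE; apply: eq_bigr.
apply: is_derive_eq; rewrite !mxE -big_split /=; apply: eq_bigr => l _.
by rewrite addrC [_ *: dF i l]mulrC.
Qed.

Lemma is_derive_trmx (R : realFieldType) (V : normedModType R) (m n : nat)
    (F : V -> 'M[R]_(m, n)) (t v : V) dF :
  is_derive t v F dF -> is_derive t v (fun x => (F x)^T) dF^T.
Proof.
move=> /is_derive_mxP Ft; apply/is_derive_mxP => i j; rewrite mxE.
by rewrite (_ : (fun _ => _) = fun x => F x j i) //; apply/funext => x; rewrite mxE.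
Qed.

(** * Rotation curves and the velocities they produce *)

(* Rodrigues' formula: this is exp (t B) when B^3 = - B. *)
Definition rotation_mx (R : realType) (n : nat) (B : 'M[R]_n) (t : R) :=
  1%:M + sin t *: B + (1 - cos t) *: (B *m B).

Section Rotation.
Variables (R : realType) (n : nat) (B : 'M[R]_n).
Hypotheses (Bskew : B^T = - B) (Bcube : B *m B *m B = - B).

Lemma rotation_mx0 : rotation_mx B 0 = 1%:M.
Proof. by rewrite /rotation_mx sin0 cos0 subrr !scale0r !addr0. Qed.

Lemma tr_rotation_mx t :
  (rotation_mx B t)^T = 1%:M - sin t *: B + (1 - cos t) *: (B *m B).
Proof.
rewrite /rotation_mx !linearD /= !linearZ /= trmx1 trmx_mul Bskew.
by rewrite mulNmx mulmxN opprK scalerN.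
Qed.

(** Since B^4 = - B^2, the product with the transpose is 1 plus B^2 times 2 (1 - cos t) - sin^2 t -
    (1 - cos t)^2, which is 0. *)
Lemma orthogonal_rotation_mx t : orthogonal_mx (rotation_mx B t).
Proof.
rewrite /orthogonal_mx tr_rotation_mx /rotation_mx.
rewrite !(mulmxDl, mulmxDr) !(mulmxN, mulNmx, mul1mx, mulmx1).
rewrite -!scalemxAl -!scalemxAr !(mulmxA, Bcube).
rewrite !(mulmxN, mulNmx, scalerN, opprK, scalerA).
have sc : sin t * sin t = 1 - cos t * cos t.
  by rewrite -!expr2 -(cos2Dsin2 t); ring.
rewrite sc.
apply/matrixP => i j; rewrite !mxE; ring.
Qed.

Lemma is_derive_rotation_mx (t : R) :
  is_derive t 1 (rotation_mx B) (rotation_mx B t *m B).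
Proof.
apply/is_derive_mxP => i j.
rewrite (_ : (fun _ => _) = cst (1%:M i j) + B i j *: (sin : R -> R)
    + (B *m B) i j *: (cst 1 - (cos : R -> R))); last first.
  apply/funext => x; rewrite !fctE !mxE /= /GRing.scale /=; ring.
apply: is_derive_eq.
rewrite /rotation_mx !mulmxDl mul1mx -!scalemxAl Bcube !mxE /GRing.scale /=; ring.
Qed.

Lemma is_derive_conj_rotation_mx Z (t : R) :
  is_derive t 1 (fun t => rotation_mx B t *m Z *m (rotation_mx B t)^T)
    (rotation_mx B t *m (B *m Z - Z *m B) *m (rotation_mx B t)^T).
Proof.
have dG := is_derive_rotation_mx t.
have dGT := is_derive_trmx dG.
have dGZ := is_derive_mulmx dG (is_derive_cst Z t (1 : R)).
have := is_derive_mulmx dGZ dGT; congr is_derive.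
rewrite mulmx0 addr0 trmx_mul Bskew.
by rewrite mulNmx mulmxN mulmxBr mulmxBl !mulmxA.
Qed.

(** Needed for smoothness of the curve: differentiating replaces Z by BZ - ZB, so all iterated
    derivatives stay in the same family of derivable functions. *)
Lemma derive1n_conj_rotation_mx Z m :
  exists Zm, derive1n m (fun t => rotation_mx B t *m Z *m (rotation_mx B t)^T)
    = fun t => rotation_mx B t *m Zm *m (rotation_mx B t)^T.
Proof.
elim: m => [|m [Zm IHm]]; first by exists Z.
exists (B *m Zm - Zm *m B); rewrite derive1nS IHm; apply/funext => t.
by rewrite derive1E; have ? := is_derive_conj_rotation_mx Zm t; exact: derive_val.
Qed.

Lemma tangent_space_rotation (M : set 'M[R]_n) (X : 'M[R]_n) :
  (forall V Z, orthogonal_mx V -> M Z -> M (V *m Z *m V^T)) -> M X ->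
  tangent_space M X (B *m X - X *m B).
Proof.
(* The curve stays in [M] for all times, so the radius 1 is an arbitrary choice. *)
move=> Mconj MX; exists 1 => //.
exists (fun t => rotation_mx B t *m X *m (rotation_mx B t)^T); split.
- by move=> t _; apply: Mconj => //; exact: orthogonal_rotation_mx.
- move=> m t _; have [Zm ->] := derive1n_conj_rotation_mx X m.
  by have ? := is_derive_conj_rotation_mx Zm t; exact: ex_derive.
- by rewrite rotation_mx0 trmx1 mul1mx mulmx1.
- rewrite derive1E; have ? := is_derive_conj_rotation_mx X 0.
  by rewrite derive_val rotation_mx0 trmx1 mul1mx mulmx1.
Qed.

End Rotation.

(** * Skew test matrices, and linear algebra of diagonal matrices *)

Lemma skew_mx_eq0 (R : numDomainType) (n : nat) (K : 'M[R]_n) :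
  K^T = - K ->
  (forall B : 'M[R]_n, B^T = - B -> B *m B *m B = - B -> \tr (B *m K) = 0) ->
  K = 0.
Proof.
move=> /matrixP Kskew trK0; apply/matrixP => i j; rewrite [RHS]mxE.
have Kji : K j i = - K i j by have := Kskew i j; rewrite !mxE.
have [ij|ij] := eqVneq i j.
  move: Kji; rewrite ij => /eqP.
  by rewrite -addr_eq0 -mulr2n mulrn_eq0 /= => /eqP.
(* The generator of rotations in the (i, j) coordinate plane satisfies B^3 = - B, and tr(BK) = K_ji
   - K_ij = - 2 K_ij. *)
pose B : 'M[R]_n := delta_mx i j - delta_mx j i.
have Bskew : B^T = - B by rewrite /B linearB /= !trmx_delta opprB.
have Bcube : B *m B *m B = - B.
  rewrite /B !(mulmxBl, mulmxBr) !mul_delta_mx_cond.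
  rewrite !(eqxx, negbTE ij, eq_sym j i) !(mulr0n, mulr1n, subr0, sub0r, mul0mx).
  rewrite !mul_delta_mx_cond !(eqxx, negbTE ij, eq_sym j i).
  by rewrite !(mulr0n, mulr1n, oppr0, subr0, sub0r, opprK, opprB, addr0) addrC.
have := trK0 B Bskew Bcube.
have trd k l : \tr (delta_mx k l *m K) = K l k.
  rewrite /mxtrace (bigD1 k) //= big1 ?addr0 => [|m mk].
    rewrite mxE (bigD1 l) //= big1 ?addr0 ?mxE ?eqxx ?mul1r // => m ml.
    by rewrite mxE (negbTE ml) andbF mul0r.
  by rewrite mxE big1 // => q _; rewrite mxE (negbTE mk) mul0r.
rewrite /B mulmxBl linearB /= !trd Kji -opprD => /eqP.
by rewrite oppr_eq0 -mulr2n mulrn_eq0 /= => /eqP.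
Qed.

(** Entrywise, commutation reads X_ij (a_j - a_i) = 0. *)
Lemma comm_diag_mx_diag (F : fieldType) (n : nat) (a : 'rV[F]_n) (X : 'M[F]_n) :
  injective (a 0) -> X *m diag_mx a = diag_mx a *m X ->
  exists x, X = diag_mx x.
Proof.
move=> ainj; rewrite mul_mx_diag mul_diag_mx => /matrixP XaaX.
apply/diag_mxP/is_diag_mxP => i j ij.
have := XaaX i j; rewrite !mxE mulrC => /eqP.
rewrite -subr_eq0 -mulrBl mulf_eq0 subr_eq0 => /orP[/eqP/ainj ji|/eqP //].
by rewrite ji eqxx in ij.
Qed.

(** Entrywise V_ij (d_j - x_i) = 0, so x_i = d_(s i) for any permutation s such that all V_(i, s i)
    are nonzero. Multiplicities are thereby matched as well. *)
Lemma diag_mx_intertwine (F : fieldType) (n : nat) (V : 'M[F]_n)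
    (d x : 'rV[F]_n) :
  V \in unitmx -> V *m diag_mx d = diag_mx x *m V ->
  exists s : 'S_n, forall i, x 0 i = d 0 (s i).
Proof.
rewrite mul_mx_diag mul_diag_mx unitmxE unitfE => detV /matrixP VdxV.
(* Some term of the Leibniz expansion of the determinant of V is nonzero. *)
have [s Vs] : exists s : 'S_n, \prod_i V i (s i) != 0.
  apply: contrapT => noperm; move: detV; rewrite /determinant big1 ?eqxx // => s _.
  case: (eqVneq (\prod_i V i (s i)) 0) => [->|Vs]; first by rewrite mulr0.
  by exfalso; apply: noperm; exists s.
exists s => i; have := VdxV i (s i); rewrite !mxE mulrC => /(mulIf _) -> //.
by move/prodf_neq0: Vs; apply.
Qed.

(** If v is a row eigenvector, then vP is one for the diagonal matrix, and any nonzero coordinate of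
    vP picks the entry of [a]. *)
Lemma eigenvalue_conj_diag (F : fieldType) (n : nat) (P P' : 'M[F]_n)
    (a : 'rV[F]_n) (x : F) :
  P *m P' = 1%:M -> eigenvalue (P *m diag_mx a *m P') x -> exists i, a 0 i = x.
Proof.
move=> PP' /eigenvalueP[v vA v0].
have /rV0Pn[i wi] : v *m P != 0.
  by apply: contra v0 => /eqP vP0; rewrite -(mulmx1 v) -PP' mulmxA vP0 mul0mx.
exists i; have : v *m P *m diag_mx a = x *: (v *m P).
  by rewrite scalemxAl -vA -!mulmxA (mulmx1C PP') mulmx1.
move: (v *m P) wi => w wi; rewrite mul_mx_diag => /rowP/(_ i).
by rewrite !mxE mulrC => /(mulIf wi).
Qed.

(** * The matrix polynomial \prod_j (X - b_j) under conjugation, at diagonal matrices and along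
    curves *)

Section Products.
Variables (R : realType) (n : nat) (I : Type) (b : I -> R).

Lemma prod_conj_sub (r : seq I) (V X : 'M[R]_n) : orthogonal_mx V ->
  \prod_(j <- r) (V *m X *m V^T - (b j)%:M)
  = V *m (\prod_(j <- r) (X - (b j)%:M)) *m V^T.
Proof.
move=> VVT; elim: r => [|j r IHr]; first by rewrite !big_nil mulmx1.
rewrite !big_cons IHr -!mulmxE.
have -> : V *m X *m V^T - (b j)%:M = V *m (X - (b j)%:M) *m V^T.
  by rewrite mulmxBr mulmxBl mul_mx_scalar -scalemxAl VVT scalemx1.
by rewrite !mulmxA -[_ *m V^T *m V]mulmxA (mulmx1C VVT) mulmx1.
Qed.

Lemma prod_diag_sub (r : seq I) (x : 'rV[R]_n) :
  \prod_(j <- r) (diag_mx x - (b j)%:M)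
  = diag_mx (\row_i \prod_(j <- r) (x 0 i - b j)).
Proof.
elim: r => [|j r IHr].
  by rewrite big_nil; apply/matrixP => i j; rewrite !mxE big_nil.
rewrite big_cons IHr -mulmxE mul_mx_diag; apply/matrixP => i l; rewrite !mxE.
case: eqVneq => [->|_]; last by rewrite !mulr0n subr0 mul0r.
by rewrite !mulr1n big_cons.
Qed.

(** The factors need not commute with Y, but at time 0 they are diagonal. On the diagonal of the
    Leibniz sum they therefore act as scalars, which gives Y_ii times the derivative of the scalar
    polynomial at x_i. *)
Lemma derive_prod_sub (r : seq I) (c : R -> 'M[R]_n) (x : 'rV[R]_n) Y :
  is_derive (0 : R) 1 c Y -> c 0 = diag_mx x ->
  exists2 D, is_derive (0 : R) 1 (fun t => \prod_(j <- r) (c t - (b j)%:M)) D &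
    forall i, D i i = Y i i * (\prod_(j <- r) ('X - (b j)%:P))^`().[x 0 i].
Proof.
move=> dc c0; elim: r => [|j r [D dD Dii]].
  exists 0 => [|i]; last by rewrite big_nil -polyC1 derivC horner0 mulr0 mxE.
  rewrite (_ : (fun _ => _) = cst 1); first exact: is_derive_cst.
  by apply/funext => t; rewrite big_nil.
have dcj : is_derive (0 : R) 1 (fun t => c t - (b j)%:M) Y.
  by have := is_deriveB dc (is_derive_cst (b j)%:M (0 : R) 1); rewrite subr0.
exists (Y *m (\prod_(l <- r) (c 0 - (b l)%:M)) + (c 0 - (b j)%:M) *m D).
  rewrite (_ : (fun _ => _) = fun t => (c t - (b j)%:M) *m
      \prod_(j <- r) (c t - (b j)%:M)); first exact: (is_derive_mulmx dcj dD).
  by apply/funext => t; rewrite big_cons.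
move=> i; rewrite c0 prod_diag_sub mul_mx_diag big_cons derivM.
have -> : diag_mx x - (b j)%:M = diag_mx (\row_l (x 0 l - b j)).
  apply/matrixP => k l; rewrite !mxE.
  by case: eqVneq => [->|_]; rewrite ?mulr1n // !mulr0n subr0.
rewrite mul_diag_mx !mxE Dii derivXsubC mul1r !hornerE horner_prod.
rewrite mulrDr; congr (_ * _ + _); first by apply: eq_bigr => l _; rewrite !hornerE.
by rewrite /= mulrCA mulrA.
Qed.

End Products.

(** At b_j only the Leibniz term differentiating 'X - b_j survives, namely the product of the b_j -
    b_i over i != j. *)
Lemma deriv_prod_XsubC_neq0 (F : idomainType) (I : finType) (b : I -> F) (j : I) :
  injective b -> (\prod_i ('X - (b i)%:P))^`().[b j] != 0.
Proof.
move=> binj; rewrite (bigD1 j) //= derivM derivXsubC mul1r !hornerE subrr mul0r addr0.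
rewrite horner_prod; apply/prodf_neq0 => i ij; rewrite !hornerE subr_eq0.
by apply: contra ij => /eqP/binj ->.
Qed.

(** * Conjugation by orthogonal and permutation matrices *)

Lemma orthogonal_mx_tr (R : realType) (n : nat) (Q : 'M[R]_n) :
  orthogonal_mx Q -> orthogonal_mx Q^T.
Proof. by rewrite /orthogonal_mx trmxK => /mulmx1C. Qed.

Lemma conj_orthogonal_mxK (R : realType) (n : nat) (Q X : 'M[R]_n) :
  orthogonal_mx Q -> Q *m (Q^T *m X *m Q) *m Q^T = X.
Proof.
by move=> QQT; rewrite !mulmxA QQT mul1mx -mulmxA QQT mulmx1.
Qed.

Lemma conj_orthogonal_trK (R : realType) (n : nat) (Q X : 'M[R]_n) :
  orthogonal_mx Q -> Q^T *m (Q *m X *m Q^T) *m Q = X.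
Proof.
by move=> /orthogonal_mx_tr QTQ; have := conj_orthogonal_mxK X QTQ; rewrite trmxK.
Qed.

Lemma orthogonal_perm_mx (R : realType) (n : nat) (s : 'S_n) :
  orthogonal_mx (perm_mx s : 'M[R]_n).
Proof. by rewrite /orthogonal_mx tr_perm_mx -perm_mxM mulgV perm_mx1. Qed.

Lemma perm_mx_conj_diag (R : pzSemiRingType) (n : nat) (s : 'S_n) (d : 'rV[R]_n) :
  perm_mx s *m diag_mx d *m (perm_mx s)^T = diag_mx (\row_i d 0 (s i)).
Proof.
rewrite tr_perm_mx -col_permE -row_permE; apply/matrixP => i j.
by rewrite !mxE (inj_eq perm_inj).
Qed.

(** * Stationary points on any conjugation-invariant set of symmetric matrices annihilated by
    \prod_j ('X - b_j); both models are instances *)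

Section Stationary.
Variables (R : realType) (n : nat) (I : finType) (b : I -> R).
Variables (M : set 'M[R]_n) (A Q : 'M[R]_n) (a : 'rV[R]_n).
Hypotheses (binj : injective b) (ainj : injective (a 0)).
Hypotheses (QQT : orthogonal_mx Q) (AQ : A = Q *m diag_mx a *m Q^T).
Hypothesis Mconj : forall V X, orthogonal_mx V -> M X -> M (V *m X *m V^T).
Hypothesis Msym : forall X, M X -> symmetric_mx X.
Hypothesis Mroot : forall X, M X -> \prod_j (X - (b j)%:M) = 0.

Lemma stationary_comm X : stationary_points M A X -> A *m X = X *m A.
Proof.
move=> [MX statX].
have AT : A^T = A by rewrite AQ !trmx_mul trmxK tr_diag_mx mulmxA.
have XT := Msym MX.
(* AX - XA is skew because A and X are symmetric. *)
apply/eqP; rewrite -subr_eq0; apply/eqP; apply: skew_mx_eq0 => [|B BT B3].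
  by rewrite linearB /= !trmx_mul AT XT opprB.
have := statX _ (tangent_space_rotation BT B3 Mconj MX).
have -> : (B *m X - X *m B)^T = B *m X - X *m B.
  by rewrite linearB /= !trmx_mul BT XT mulmxN mulNmx opprK addrC.
move=> <-.
(* By cyclicity of the trace the terms in X^2 cancel in tr((BX - XB)(X - A)), leaving tr(B (AX -
   XA)). *)
have trXB Z : \tr (X *m B *m Z) = \tr (B *m Z *m X).
  by rewrite -mulmxA mxtrace_mulC.
rewrite !(mulmxBr, mulmxBl) !linearB /= !mulmxA !trXB; ring.
Qed.

Lemma tangent_diag_eq0 x Y : M (Q *m diag_mx x *m Q^T) ->
  tangent_space M (Q *m diag_mx x *m Q^T) Y -> forall i, (Q^T *m Y *m Q) i i = 0.
Proof.
set X := Q *m _ *m _ => MX [e e0 [c [Mc cdiff c0 c'0]]] i.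
have QTQ := orthogonal_mx_tr QQT.
have MQ Z : M Z -> M (Q^T *m Z *m Q).
  by move=> /(Mconj QTQ); rewrite trmxK.
have dc : is_derive (0 : R) 1 c Y.
  apply: DeriveDef; last by rewrite -derive1E.
  by apply: (cdiff 0%N); rewrite normr0.
have dQc : is_derive (0 : R) 1 (fun t => Q^T *m c t *m Q) (Q^T *m Y *m Q).
  have dQ := is_derive_cst Q (0 : R) 1.
  have := is_derive_mulmx (is_derive_mulmx (is_derive_cst Q^T (0 : R) 1) dc) dQ.
  by rewrite mul0mx add0r mulmx0 addr0.
have Qc0 : Q^T *m c 0 *m Q = diag_mx x by rewrite c0 conj_orthogonal_trK.
have [D dD Dii] := derive_prod_sub b (index_enum I) dQc Qc0.
(* The product vanishes identically along the conjugated curve near time 0, hence so does its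
   derivative there. *)
have D0 : D = 0.
  rewrite -(@derive_val _ _ _ _ _ _ _ dD).
  rewrite (@near_eq_derive _ _ _ _ (cst 0)) ?derive_cst //.
  near=> t; apply/Mroot/MQ/Mc.
  by near: t; exact: (@nbhs0_lt R R).
have [j xj] : exists j, x 0 i = b j.
  have := Mroot (MQ _ MX); rewrite conj_orthogonal_trK // prod_diag_sub.
  move=> /matrixP/(_ i i); rewrite !mxE eqxx mulr1n => /eqP/prodf_eq0[j _].
  by rewrite subr_eq0 => /eqP xj; exists j.
have := Dii i; rewrite D0 mxE xj => /esym/eqP; rewrite mulf_eq0.
by rewrite (negbTE (deriv_prod_XsubC_neq0 j binj)) orbF => /eqP.
Unshelve. all: by end_near.
Qed.

Lemma stationary_conj_diag X : M X ->
  (stationary_points M A X <-> exists x, X = Q *m diag_mx x *m Q^T).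
Proof.
move=> MX; split=> [statX|[x XQ]].
  have [x Xx] : exists x, Q^T *m X *m Q = diag_mx x.
    apply: (comm_diag_mx_diag ainj).
    have -> : diag_mx a = Q^T *m A *m Q by rewrite AQ conj_orthogonal_trK.
    rewrite !mulmxA -(mulmxA _ Q Q^T) QQT mulmx1.
    rewrite -(mulmxA _ Q Q^T) QQT mulmx1 -(mulmxA Q^T X).
    by rewrite -(stationary_comm statX) mulmxA.
  by exists x; rewrite -Xx conj_orthogonal_mxK.
split=> // Y; rewrite XQ => tY; rewrite XQ in MX; have Yii := tangent_diag_eq0 MX tY.
(* The trace becomes that of (Q^T Y Q)^T times diag(x - a), which sees only the diagonal of Q^T Y
   Q. *)
rewrite AQ -mulmxBl -mulmxBr mulmxA mxtrace_mulC !mulmxA.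
have -> : Q^T *m Y^T *m Q = (Q^T *m Y *m Q)^T by rewrite !trmx_mul trmxK mulmxA.
move: (Q^T *m Y *m Q) Yii => Z Zii.
rewrite -linearB /= mul_mx_diag /mxtrace big1 // => i _.
by rewrite mxE mxE Zii mul0r.
Qed.

End Stationary.

(** * Block indices of a flag type *)

Section FlagType.
Variables (p n : nat) (k : nat -> nat).
Hypothesis hk : flag_type p n k.

Lemma flag_type_leq i j : (i <= j)%N -> (j <= p.+1)%N -> (k i <= k j)%N.
Proof.
have [_ klt _] := hk.
elim: j => [|j IHj]; first by rewrite leqn0 => /eqP ->.
rewrite leq_eqVlt ltnS => /predU1P[-> //|ij] jp.
by apply: (leq_trans (IHj ij (ltnW jp))); apply/ltnW/klt.
Qed.

(** The block function [e] turns [block_diag] into the diagonal matrix of b o e, so that permuting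
    its entries amounts to rearranging the values of [e]. *)
Lemma flag_block_index :
  exists e : 'I_n -> 'I_p.+1, forall (i : 'I_n) (j : 'I_p.+1),
    (k j <= i < k j.+1)%N = (e i == j).
Proof.
have [k0 klt kn] := hk.
suff /choice[e eP] : forall i : 'I_n, exists j : 'I_p.+1,
    (k j <= i < k j.+1)%N.
  exists e => i j; have [<-|eij] := eqVneq; first exact: eP.
  have /andP[kei ike] := eP i.
  apply/negbTE/negP => /andP[kji ikj].
  case/negP: eij; rewrite -val_eqE eqn_leq /=; apply/andP; split; rewrite leqNgt.
    apply/negP => /flag_type_leq/(_ (ltnW (ltn_ord _))) kk.
    by have := leq_trans (leq_trans ikj kk) kei; rewrite ltnn.
  apply/negP => /flag_type_leq/(_ (ltnW (ltn_ord _))) kk.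
  by have := leq_trans (leq_trans ike kk) kji; rewrite ltnn.
move=> i; have exk : exists m, (i < k m)%N by exists p.+1; rewrite kn.
(* The least m with i < k m is positive because k 0 = 0; its predecessor is the block of i. *)
case: (ex_minnP exk) => -[|m]; first by rewrite k0.
move=> ikm minm; have mp : (m < p.+1)%N by apply: minm; rewrite kn.
exists (Ordinal mp); rewrite /= ikm andbT leqNgt.
by apply/negP => /minm; rewrite ltnn.
Qed.

Variable e : 'I_n -> 'I_p.+1.
Hypothesis eP : forall (i : 'I_n) (j : 'I_p.+1), (k j <= i < k j.+1)%N = (e i == j).

Lemma count_block_index (j : 'I_p.+1) :
  count_mem j [tuple e i | i < n] = flag_mult k j.
Proof.
have [_ _ kn] := hk.
have kjn : (k j.+1 <= n)%N by rewrite -kn flag_type_leq.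
rewrite count_map -sum1_count big_enum_cond /=.
under eq_bigl do rewrite -eP.
rewrite -(big_mkord (fun i => (k j <= i < k j.+1)%N) (fun=> 1%N)).
(* The multiplicity is a sum of ones over k j <= i < k j.+1, whose bounds are then turned into
   conditions on 0 <= i < n. *)
rewrite -[RHS]muln1 -sum_nat_const_nat.
rewrite [RHS](big_nat_widenl _ 0%N) // [RHS](big_nat_widen _ _ n) //.
Qed.

Lemma block_diagE (R : realType) (b : 'I_p.+1 -> R) :
  block_diag n k b = diag_mx (\row_i b (e i)).
Proof.
congr diag_mx; apply/rowP => i; rewrite !mxE.
by under eq_bigl do rewrite eP eq_sym; rewrite big_pred1_eq.
Qed.

End FlagType.

(** Groups the indices by their value under [f]. It serves for traces over the reals and, with
    weights 1 in [nat], for the total of the multiplicities. *)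
Lemma sum_count_mem (R : pzSemiRingType) (I : finType) (n : nat) (f : 'I_n -> I)
    (b : I -> R) :
  \sum_i b (f i) = \sum_j (count_mem j [tuple f i | i < n])%:R * b j.
Proof.
rewrite (partition_big f xpredT) //=; apply: eq_bigr => j _.
rewrite count_map -sum1_count big_enum_cond natr_sum big_distrl /=.
by apply: eq_bigr => i /eqP ->; rewrite mul1r.
Qed.

(** * The two models and their diagonal members *)

Section Models.
Variables (R : realType) (p n : nat) (k : nat -> nat) (b : 'I_p.+1 -> R).
Hypothesis hk : flag_type p n k.

Lemma isospectral_flag_conj (V X : 'M[R]_n) : orthogonal_mx V ->
  isospectral_flag k b X -> isospectral_flag k b (V *m X *m V^T).
Proof.
move=> VVT [XT Xroot Xtr]; split.
- by rewrite /symmetric_mx !trmx_mul trmxK XT mulmxA.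
- by rewrite prod_conj_sub // Xroot mulmx0 mul0mx.
- by rewrite mxtrace_mulC mulmxA (mulmx1C VVT) mul1mx.
Qed.

Lemma isospectral_orbit_conj (V X : 'M[R]_n) : orthogonal_mx V ->
  isospectral_orbit k b X -> isospectral_orbit k b (V *m X *m V^T).
Proof.
move=> VVT [W WWT ->]; exists (V *m W); last by rewrite trmx_mul !mulmxA.
by rewrite /orthogonal_mx trmx_mul mulmxA -(mulmxA V) WWT mulmx1.
Qed.

Variable e : 'I_n -> 'I_p.+1.
Hypothesis eP :
  forall (i : 'I_n) (j : 'I_p.+1), (k j <= i < k j.+1)%N = (e i == j).

Lemma isospectral_flag_block_diag : isospectral_flag k b (block_diag n k b).
Proof.
rewrite (block_diagE eP); split.
- exact: tr_diag_mx.
- rewrite prod_diag_sub; apply/matrixP => i j; rewrite !mxE.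
  by rewrite (bigD1 (e i)) //= subrr mul0r mul0rn.
- rewrite mxtrace_diag; under eq_bigr do rewrite mxE.
  rewrite sum_count_mem; apply: eq_bigr => j _.
  by rewrite (count_block_index hk eP).
Qed.

Lemma isospectral_orbit_block_diag : isospectral_orbit k b (block_diag n k b).
Proof.
by exists 1%:M; rewrite /orthogonal_mx ?trmx1 ?mulmx1 ?mul1mx.
Qed.

Lemma isospectral_orbit_sub_flag :
  isospectral_orbit (n := n) k b `<=` isospectral_flag k b.
Proof.
by move=> X [V VVT ->]; apply/isospectral_flag_conj/isospectral_flag_block_diag.
Qed.

Lemma isospectral_orbit_diag (x : 'rV[R]_n) :
  isospectral_orbit k b (diag_mx x) ->
  exists s : 'S_n, forall i, x 0 i = b (e (s i)).
Proof.
rewrite /isospectral_orbit (block_diagE eP) => -[V VVT xV].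
have Vunit : V \in unitmx by case/mulmx1_unit: VVT.
have /diag_mx_intertwine[//|s xs] : V *m diag_mx (\row_i b (e i)) = diag_mx x *m V.
  by rewrite xV -mulmxA (mulmx1C VVT) mulmx1.
by exists s => i; rewrite xs mxE.
Qed.

(** The polynomial equation puts each x_i among the b_j, and the trace equation with
    [trace_determines_mult] fixes how often each occurs. Equal counts then give a permutation. *)
Lemma isospectral_flag_diag (x : 'rV[R]_n) :
  trace_determines_mult n k b -> isospectral_flag k b (diag_mx x) ->
  exists s : 'S_n, forall i, x 0 i = b (e (s i)).
Proof.
move=> hdet [_ xroot xtr].
have /choice[f xf] : forall i, exists j, x 0 i = b j.
  move=> i; move/matrixP/(_ i i): xroot; rewrite prod_diag_sub !mxE eqxx mulr1n.
  by move/eqP/prodf_eq0 => [j _]; rewrite subr_eq0 => /eqP xj; exists j.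
have count_f j : count_mem j [tuple f i | i < n] = flag_mult k j.
  apply: (hdet (fun j => count_mem j [tuple f i | i < n])).
    transitivity (\sum_(i < n) 1)%N; last by rewrite sum1_card card_ord.
    rewrite [RHS](sum_count_mem f (fun=> 1%N)).
    by apply: eq_bigr => l _; rewrite mulr1 natn.
  rewrite -sum_count_mem -xtr mxtrace_diag.
  by apply: eq_bigr => i _; rewrite xf.
have /tuple_permP[s fs] : perm_eq [tuple f i | i < n] [tuple e i | i < n].
  apply/allP => j _ /=; apply/eqP.
  by rewrite [LHS]count_f [RHS](count_block_index hk eP).
exists s => i; rewrite xf; congr b.
have := congr1 (fun t : seq _ => nth (f i) t i) fs.
by rewrite -!tnth_nth !tnth_mktuple.
Qed.

End Models.

(** * Cardinality, characterization and count of the stationary points *)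

Lemma card_eq_uniq (T : choiceType) (s : seq T) :
  uniq s -> [set` s] #= `I_(size s).
Proof.
move=> us; apply/card_set_bijP; exists (index^~ s); split.
- by move=> x /=; rewrite index_mem.
- move=> x y; rewrite !inE /= => xs ys exy.
  by rewrite -(nth_index x xs) exy nth_index.
- move=> i /= si; case: s us si => // x s us si.
  exists (nth x (x :: s) i); first exact: mem_nth.
  exact: index_uniq.
Qed.

Theorem proposition3p1 (R : realType) (p n : nat) (k : nat -> nat)
    (b : 'I_p.+1 -> R) (M : set 'M[R]_n) (A Q : 'M[R]_n) (a : 'rV[R]_n)
    (hk : flag_type p n k)
    (hb : injective b)
    (hM : (M = isospectral_flag k b /\ trace_determines_mult n k b)
          \/ M = isospectral_orbit k b)
    (hA : symmetric_mx A)
    (hAeig : distinct_eigenvalues A)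
    (hQ : orthogonal_mx Q)
    (hAQ : A = Q *m diag_mx a *m Q^T) :
  (forall X : 'M[R]_n, M X ->
     (stationary_points M A X <->
      exists tau : 'S_n,
        X = Q *m perm_mx tau *m block_diag n k b *m (perm_mx tau)^T *m Q^T))
  /\ stationary_points M A #=
       `I_(n`! %/ \prod_(j < p.+1) (flag_mult k j)`!)%N.
Proof.
have [e eP] := flag_block_index hk.
have ainj : injective (a 0).
  have [s [us sn /allP As]] := hAeig.
  (* The n distinct eigenvalues all occur among the n entries of [a], so these entries cannot
     repeat. *)
  apply/injectiveP; apply: (leq_size_uniq us); last by rewrite size_codom card_ord sn.
  move=> x /As; rewrite hAQ => /(eigenvalue_conj_diag hQ)[i <-].
  exact: codom_f.
(* The choice of model enters only through the next four facts. *)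
have Mflag X : M X -> isospectral_flag k b X.
  by case: hM => [[-> _]//|->]; exact: (isospectral_orbit_sub_flag hk eP).
have Mconj V X : orthogonal_mx V -> M X -> M (V *m X *m V^T).
  by case: hM => [[-> _]|->]; [exact: isospectral_flag_conj|
                               exact: isospectral_orbit_conj].
have Mblock : M (block_diag n k b).
  case: hM => [[-> _]|->]; first exact: (isospectral_flag_block_diag _ hk eP).
  exact: isospectral_orbit_block_diag.
have Mdiag x : M (diag_mx x) -> exists s : 'S_n, forall i, x 0 i = b (e (s i)).
  case: hM => [[-> hdet]|->]; first exact: (isospectral_flag_diag hk eP hdet).
  exact: (isospectral_orbit_diag eP).
(* The candidate point attached to a sequence of block indices; it is used on sequences of size n,
   where the default [ord0] is never read. *)
pose conjb (t : seq 'I_p.+1) : 'M[R]_n :=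
  Q *m diag_mx (\row_i b (nth ord0 t i)) *m Q^T.
have conjbE tau :
    Q *m perm_mx tau *m block_diag n k b *m (perm_mx tau)^T *m Q^T
    = conjb [tuple e (tau i) | i < n].
  rewrite (block_diagE eP) -(mulmxA Q) -(mulmxA Q) perm_mx_conj_diag.
  congr (_ *m diag_mx _ *m _); apply/rowP => i.
  by rewrite !mxE -tnth_nth tnth_mktuple.
have Mperm tau :
    M (Q *m perm_mx tau *m block_diag n k b *m (perm_mx tau)^T *m Q^T).
  rewrite -(mulmxA Q) -(mulmxA Q); apply: (Mconj) => //.
  by apply: Mconj => //; exact: orthogonal_perm_mx.
have statP X : M X -> (stationary_points M A X <-> exists tau : 'S_n,
    X = Q *m perm_mx tau *m block_diag n k b *m (perm_mx tau)^T *m Q^T).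
  move=> MX; have Msym Z : M Z -> symmetric_mx Z by case/Mflag.
  have Mroot Z : M Z -> \prod_j (Z - (b j)%:M) = 0 by case/Mflag.
  apply: (iff_trans (stationary_conj_diag hb ainj hQ hAQ Mconj Msym Mroot MX)).
  split=> [[x XQ]|[tau ->]].
    have := Mconj _ _ (orthogonal_mx_tr hQ) MX.
    rewrite XQ trmxK conj_orthogonal_trK // => /Mdiag[s xs]; exists s.
    rewrite conjbE; congr (_ *m diag_mx _ *m _); apply/rowP => i.
    by rewrite !mxE xs -tnth_nth tnth_mktuple.
  by rewrite conjbE; eexists.
split=> //; set t0 := [tuple e i | i < n].
have st0 : size t0 = n := size_tuple t0.
have perm_t0 (t : seq 'I_p.+1) :
    perm_eq t t0 <-> exists tau : 'S_n, t = [tuple e (tau i) | i < n].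
  split=> [/(@tuple_permP _ n)[tau ->]|[tau ->]].
    by exists tau; congr tval; apply: eq_mktuple => i; rewrite tnth_mktuple.
  apply/(@tuple_permP _ n); exists tau.
  by congr tval; apply: eq_mktuple => i; rewrite tnth_mktuple.
have -> : stationary_points M A = conjb @` [set` permutations t0].
  apply/seteqP; split=> [X statX|_ [t + <-]] /=.
    have [tau ->] := (statP X statX.1).1 statX.
    exists [tuple e (tau i) | i < n]; last by rewrite conjbE.
    by rewrite /= mem_permutations; apply/perm_t0; exists tau.
  rewrite /= mem_permutations => /perm_t0[tau tE].
  have -> : conjb t =
      Q *m perm_mx tau *m block_diag n k b *m (perm_mx tau)^T *m Q^T.
    by rewrite conjbE tE.
  by apply/statP => //; exists tau.
(* Undoing the conjugation by Q exposes the diagonal entries b(t_i), and these determine t since b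
   is injective. *)
have conjb_inj : {in [set` permutations t0] &, injective conjb}.
  move=> t u; rewrite !inE /= !mem_permutations.
  move=> /perm_size tt0 /perm_size ut0.
  have tn : size t = n := etrans tt0 st0; have un : size u = n := etrans ut0 st0.
  move=> /(congr1 (fun Z => Q^T *m Z *m Q)); rewrite !conj_orthogonal_trK //.
  move=> /matrixP tu; apply: (@eq_from_nth _ ord0); rewrite tn ?un // => i lt_in.
  have := tu (Ordinal lt_in) (Ordinal lt_in); rewrite !mxE eqxx !mulr1n.
  exact: hb.
apply: card_eq_trans (inj_card_eq conjb_inj) _.
apply: card_eq_trans (card_eq_uniq (permutations_uniq _)) _.
have := size_permutations_count t0; rewrite st0.
under eq_bigr do rewrite (count_block_index hk eP).
(* The division is exact: n! is the number of rearrangements times the positive product of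
   factorials. *)
by move=> <-; rewrite mulnK // prodn_gt0 // => j; rewrite fact_gt0.
Qed.
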